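(* Let $q$ be a power of a prime $p$, let $2\le t\le p$, let $n\ge1$, and let $F\in\mathbb{F}_q[x_1,\ldots,x_t]$ satisfy $$F(a,\ldots,a)=0\qquad(a\in\mathbb{F}_q).$$ If $A\subseteq\mathbb{F}_q^n$ contains no $t$ pairwise distinct elements satisfying $F=0$ coordinatewise, then $$|A|\le\sum_{\pi\in\Pi_t\setminus\{\widehat1\}}\operatorname{srk}(\mathcal{T}_{F,\pi,n}).$$ Consequently, if a sequence $S$ over $\mathbb{F}_q^n$ contains no length-$t$ subsequence on which $F$ vanishes coordinatewise, then $$|S|\le(t-1)\sum_{\pi\in\Pi_t\setminus\{\widehat1\}}\operatorname{srk}(\mathcal{T}_{F,\pi,n}).$$
   Context: $\Pi_t$ is the set of set partitions of $[t]=\{1,\dots,t\}$, and $\widehat1=\{[t]\}$ is the one-block partition. For $\pi=\{B_1,\dots,B_r\}\in\Pi_t$ (with a chosen ordering of blocks, whose choice does not affect ranks), the contraction of $F$ is $F_\pi(y_1,\dots,y_r)=F(z_1,\dots,z_t)$ with $z_j=y_i$ if $j\in B_i$. Put $\tau_{F,\pi}=1-F_\pi^{q-1}:\mathbb{F}_q^r\to\mathbb{F}_q$ and $\mathcal{T}_{F,\pi,n}=\tau_{F,\pi}^{\boxtimes n}:(\mathbb{F}_q^n)^r\to\mathbb{F}_q$, that is $\mathcal{T}_{F,\pi,n}(y_1,\dots,y_r)=\prod_{h=1}^n\tau_{F,\pi}(y_{1,h},\dots,y_{r,h})$, where $y_{i,h}$ is the $h$-th coordinate of $y_i\in\mathbb{F}_q^n$.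 A tensor (function) $T:X_1\times\cdots\times X_r\to\mathbb{F}_q$ on finite sets is a slice if for some $i$ it can be written as $f(x_i)\,g(x_1,\dots,x_{i-1},x_{i+1},\dots,x_r)$; the slice rank $\operatorname{srk}(T)$ is the least number of slices whose sum is $T$. A sequence may have repeated values; $|S|$ is its length, and a length-$t$ subsequence consists of $t$ terms with distinct indices. *)

(* Defs.v *)
From mathcomp Require Import all_boot all_order all_algebra.
From mathcomp Require Import mpoly.

Set Implicit Arguments.
Unset Strict Implicit.
Unset Printing Implicit Defensive.

Import GRing.Theory.
Local Open Scope ring_scope.

Section SliceRank.
Variables (K : finFieldType) (r : nat) (X : 'I_r -> finType).

Local Notation point := {dffun forall i : 'I_r, X i}.
Local Notation tensor := {ffun point -> K}.

Definition drop_coord (i : 'I_r) (x : point) :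
    {dffun forall j : 'I_r.-1, X (lift i j)} :=
  [ffun j => x (lift i j)].

Definition is_slice (T : tensor) : bool :=
  [exists i : 'I_r,
   exists f : {ffun X i -> K},
   exists g : {ffun {dffun forall j : 'I_r.-1, X (lift i j)} -> K},
     T == [ffun x : point => f (x i) * g (drop_coord i x)]].

Definition sum_of_slices (T : tensor) (m : nat) : bool :=
  [exists S : {ffun 'I_m -> tensor},
     [forall k, is_slice (S k)] && (T == \sum_(k < m) S k)].

Lemma drop_coord_inj (i : 'I_r) (x y : point) :
  x i = y i -> drop_coord i x = drop_coord i y -> x = y.
Proof.
move=> xyi /ffunP xy; apply/ffunP => k.
by case: (unliftP i k) => [j|] -> //; have := xy j; rewrite !ffunE.
Qed.

(* For r = 0 there are no slices at all; the guard only serves to make srk a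
   total function (with junk value 0 when r = 0). See srkP. *)
Lemma sum_of_slices_ex (T : tensor) :
  exists m, (0 < r)%N ==> sum_of_slices T m.
Proof.
have [_|r0] := posnP r; first by exists 0%N.
pose i0 := Ordinal r0; exists #|X i0|; apply/implyP => _.
pose f a := [ffun b : X i0 => (b == a)%:R : K].
pose g0 a (z : {dffun forall j : 'I_r.-1, X (lift i0 j)}) : K :=
  if [pick x : point | (x i0 == a) && (drop_coord i0 x == z)] is Some x
  then T x else 0.
pose g a := finfun (g0 a).
apply/existsP; exists [ffun k : 'I_#|X i0| =>
  [ffun x : point => f (enum_val k) (x i0) * g (enum_val k) (drop_coord i0 x)]].
apply/andP; split.
  apply/forallP => k; apply/existsP; exists i0; apply/existsP.
  exists (f (enum_val k)); apply/existsP; exists (g (enum_val k)).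
  by rewrite ffunE.
apply/eqP/ffunP => x; rewrite sum_ffunE (bigD1 (enum_rank (x i0))) //= big1.
  rewrite !ffunE /g0 enum_rankK eqxx mul1r addr0.
  case: pickP => [y /andP[/eqP y1 /eqP y2]|/(_ x)]; last by rewrite !eqxx.
  by rewrite (drop_coord_inj y1 y2).
move=> k kx; rewrite !ffunE; case: eqP => [xk|_]; last by rewrite mul0r.
by rewrite xk enum_valK eqxx in kx.
Qed.

Definition srk (T : tensor) : nat := ex_minn (sum_of_slices_ex T).

Lemma srkP (T : tensor) : (0 < r)%N ->
  sum_of_slices T (srk T) /\ (forall m, sum_of_slices T m -> (srk T <= m)%N).
Proof.
move=> r0; rewrite /srk; case: ex_minnP => m; rewrite r0 /= => Tm minm.
by split=> // m' Tm'; apply: minm.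
Qed.

End SliceRank.

Section Contraction.
Variable t : nat.

Definition setpart := {P : {set {set 'I_t}} | partition P [set: 'I_t]}.

Definition one_block : {set {set 'I_t}} := [set [set: 'I_t]].

Lemma pblock_setpart (P : setpart) (j : 'I_t) : pblock (val P) j \in val P.
Proof.
by apply: pblock_mem; rewrite (cover_partition (valP P)) inE.
Qed.

(* The blocks of P are B_i = enum_val i for i < #|P|, ordered by enum; this is
   the index of the block containing j. *)
Definition block_idx (P : setpart) (j : 'I_t) : 'I_#|val P| :=
  enum_rank_in (pblock_setpart P j) (pblock (val P) j).

Lemma block_idxP (P : setpart) (j : 'I_t) (i : 'I_#|val P|) :
  (j \in enum_val i) = (block_idx P j == i).
Proof.
have /and3P[_ tP _] := valP P.
have jP : j \in pblock (val P) j.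
  by rewrite mem_pblock (cover_partition (valP P)) inE.
have E : enum_val (block_idx P j) = pblock (val P) j.
  by rewrite /block_idx enum_rankK_in ?pblock_setpart.
apply/idP/eqP => [ji|<-]; last by rewrite E.
by apply: enum_val_inj; rewrite E (def_pblock tP (enum_valP i) ji).
Qed.

Variable K : finFieldType.

Definition contraction (F : {mpoly K[t]}) (P : setpart) :
    {mpoly K[#|val P|]} :=
  F \mPo [tuple 'X_(block_idx P j) | j < t].

Lemma contractionE (F : {mpoly K[t]}) (P : setpart) (y : 'I_#|val P| -> K) :
  (contraction F P).@[y] = F.@[fun j => y (block_idx P j)].
Proof.
rewrite /contraction comp_mpoly_meval; apply: meval_eq => j.
by rewrite tnth_mktuple mevalXU.
Qed.

Definition tau (F : {mpoly K[t]}) (P : setpart) (y : 'I_#|val P| -> K) : K :=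
  1 - (contraction F P).@[y] ^+ #|K|.-1.
Arguments tau F P y : clear implicits.

Definition tensorT (F : {mpoly K[t]}) (P : setpart) (n : nat) :
    {ffun {dffun forall i : 'I_#|val P|, (fun=> 'rV[K]_n) i} -> K} :=
  [ffun y : {dffun forall i : 'I_#|val P|, (fun=> 'rV[K]_n) i} =>
     \prod_(h < n) tau F P (fun i => y i 0 h)].

Lemma tensorTE (F : {mpoly K[t]}) (P : setpart) (n : nat) y :
  tensorT F P n y = \prod_(h < n) tau F P (fun i => y i 0 h).
Proof. by rewrite ffunE. Qed.

End Contraction.

Arguments tau {t K} F P y.

(* Main.v *)
Require Import Defs.
From mathcomp Require Import all_boot all_order all_algebra finfield.
From mathcomp Require Import mpoly.

Set Implicit Arguments.
Unset Strict Implicit.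
Unset Printing Implicit Defensive.

Import GRing.Theory.
Local Open Scope ring_scope.

(** The set bound is a rank argument for the diagonal tensor on A^t. Let Z be
    the 0/1 function on A^t which is 1 where F vanishes coordinatewise; by
    Fermat it is a product of factors 1 - F^(q-1). The hypothesis on A says
    exactly that Z vanishes on injective tuples, so [x injective] Z(x) = 0.

    The indicator of injectivity is a combination of the indicators of
    constancy on the blocks of P, over the set partitions P
    ([injective_partition_sum]). On tuples that are constant on the blocks of
    P, the function Z is the tensor attached to the contraction F_P, and on
    constant tuples it is 1 because F vanishes on the diagonal. The identity
    thus writes the diagonal tensor, scaled by the coefficient of the one-block
    partition, as a combination over P <> {[t]} of tensors
    [x constant on the blocks of P] T_P(x) ([diagonal_partition_sum]). That
    coefficient is (-1)^(t-1) (t-1)!, which is nonzero since t <= p.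

    Multiplying by the constancy indicator destroys slices: a slice f(y_i)g of
    T_P becomes a function of all the variables in the i-th block times a
    function of the others. It is however still a product over a splitting of
    the variables into two nonempty parts, so the appropriate notion is
    partition rank, and srk(T_P) bounds it ([prank_le_lift_tensor]). Partition
    rank is still at least the size of the support for diagonal tensors
    ([leq_support_diagonal], due to Naslund, after Tao's slice rank lemma),
    whence the bound on |A|.

    The sequence bound follows since the set of values of S inherits the
    hypothesis, and no value can occur t times as F vanishes on the
    diagonal. *)

(** * Vectors of large support in subspaces of small codimension *)

Section Annihilators.
Variables (K : fieldType) (X : finType).
Implicit Types (h c : {ffun X -> K}) (phis : seq {ffun X -> K}) (A : {set X}).

Definition annihilates h phis :=
  forall phi, phi \in phis -> \sum_a h a * phi a = 0.

Lemma exists_annihilator phis :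
  (size phis < #|X|)%N -> exists2 w, w != 0 & annihilates w phis.
Proof.
move=> lt_phis_X.
pose M := \matrix_(i < #|X|, j < size phis) phis`_j (enum_val i).
have kerM : kermx M != 0.
  rewrite kermx_eq0 /row_free neq_ltn.
  by rewrite (leq_ltn_trans (rank_leq_col M) lt_phis_X).
have /rowV0Pn[v vM v0] := kerM.
exists [ffun a => v 0 (enum_rank a)].
  apply: contraNneq v0 => /ffunP w0; apply/eqP/rowP => i.
  by have := w0 (enum_val i); rewrite !ffunE enum_valK mxE.
move=> phi /(nthP 0)[j j_lt <-].
have /sub_kermxP/rowP/(_ (Ordinal j_lt)) := vM.
rewrite !mxE; apply: etrans; rewrite (reindex (@enum_val X predT)) /=.
  by apply: eq_bigr => i _; rewrite ffunE enum_valK mxE.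
by exists enum_rank => i _; rewrite ?enum_rankK ?enum_valK.
Qed.

(** A subspace of codimension at most m contains a vector with at most m zero
    coordinates. As long as the support is too small, counting dimensions gives
    a nonzero vector of the subspace that vanishes on this support, and adding
    it enlarges the support; such a vector exists over small fields as
    well, where a generic one may not. *)
Lemma annihilator_large_support A phis :
  exists2 h, annihilates h phis
    & (#|A| <= size phis + #|[set a in A | h a != 0%R]|)%N.
Proof.
suff grow m : (m + size phis <= #|A|)%N ->
    exists2 h, annihilates h phis & (m <= #|[set a in A | h a != 0%R]|)%N.
  have [le_A|lt_A] := leqP #|A| (size phis).
    exists 0 => [phi _|]; last exact: leq_trans le_A (leq_addr _ _).
    by rewrite big1 // => a _; rewrite ffunE mul0r.
  have [|h h_ann h_supp] := grow (#|A| - size phis)%N.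
    by rewrite subnK // ltnW.
  by exists h => //; rewrite -leq_subLR.
elim: m => [|m IHm] m_le.
  by exists 0 => // phi _; rewrite big1 // => a _; rewrite ffunE mul0r.
have [|h h_ann] := IHm; first exact: ltnW m_le.
rewrite leq_eqVlt => /predU1P[def_m|]; last by exists h.
set S := [set a in A | h a != 0%R] in def_m.
pose delta a : {ffun X -> K} := [ffun b => (b == a)%:R].
have deltaE (w : {ffun X -> K}) a : \sum_b w b * delta a b = w a.
  rewrite (bigD1 a) //= ffunE eqxx mulr1 big1 ?addr0 // => b /negPf b_a.
  by rewrite ffunE b_a mulr0.
have S_A : S \subset A by apply/subsetP => a; rewrite inE => /andP[].
(* Outside A :\: S the new vector is forced to vanish: on S to keep the
   support already gained, off A to keep every gain inside A. *)
have [|w w0 w_ann] :=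
    @exists_annihilator (phis ++ [seq delta a | a <- enum (~: (A :\: S))]).
  rewrite size_cat size_map -cardE -(cardsC (A :\: S)) ltn_add2r.
  by rewrite cardsD (setIidPr S_A) -def_m ltn_subRL.
have w_out a : a \notin A :\: S -> w a = 0.
  move=> aAS; rewrite -(deltaE w a); apply: w_ann.
  by rewrite mem_cat map_f ?orbT // mem_enum inE.
have [b wb] : exists b, w b != 0.
  apply/existsP; apply: contraNT w0 => /existsPn w_eq0.
  by apply/eqP/ffunP => b; rewrite ffunE; have /negbNE/eqP := w_eq0 b.
have bAS : b \in A :\: S by apply: contraNT wb => /w_out ->.
exists (h + w) => [phi phi_in|].
  under eq_bigr do rewrite ffunE mulrDl.
  rewrite big_split /= h_ann // w_ann ?addr0 //.
  by rewrite mem_cat phi_in.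
have /setDP[bA bS] := bAS.
suff : b |: S \subset [set a in A | (h + w) a != 0].
  by move/subset_leq_card; rewrite cardsU1 bS -def_m.
apply/subsetP => a /setU1P[->|aS]; rewrite inE ffunE.
  rewrite bA; move: bS; rewrite inE bA /= negbK => /eqP ->.
  by rewrite add0r.
rewrite w_out ?addr0; first by move: aS; rewrite inE.
by rewrite inE aS.
Qed.

End Annihilators.

(** * Partition rank of diagonal tensors *)

Section PartitionRank.
Variables (K : fieldType) (I X : finType).
Implicit Types (x y : {ffun I -> X}) (T : {ffun {ffun I -> X} -> K}).
Implicit Types (B D : {set I}) (c h : {ffun X -> K}).

Definition depends_on B (f : {ffun I -> X} -> K) :=
  forall x y, {in B, x =1 y} -> f x = f y.

(** The tensors of partition rank at most 1 in the variables D. Variables stay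
    indexed by I and the active ones are cut out by D, so that a contraction
    does not change the type of a tensor. *)
Definition splits D T := exists B f g,
  [/\ B != set0, B \proper D, depends_on B f, depends_on (D :\: B) g
    & forall x, T x = f x * g x].

Inductive prank_le D : nat -> {ffun {ffun I -> X} -> K} -> Prop :=
| prank_le0 : prank_le D 0 0
| prank_leS m T1 T : splits D T1 -> prank_le D m T -> prank_le D m.+1 (T1 + T).

Lemma prank_leD D m1 m2 T1 T2 :
  prank_le D m1 T1 -> prank_le D m2 T2 -> prank_le D (m1 + m2) (T1 + T2).
Proof.
move=> T1_le T2_le; elim: T1_le => [|m T T' T_s _ IH]; first by rewrite add0r.
by rewrite addSn -addrA; apply: prank_leS.
Qed.

Lemma prank_leZ D m b T : prank_le D m T -> prank_le D m [ffun x => b * T x].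
Proof.
pose scale T' : {ffun {ffun I -> X} -> K} := [ffun x => b * T' x].
rewrite -/(scale T).
elim=> [|{}m T1 {}T [B [f [g [B0 BD f_B g_B TE]]]] _ IH].
  suff -> : scale 0 = 0 by left.
  by apply/ffunP => x; rewrite !ffunE mulr0.
suff -> : scale (T1 + T) = scale T1 + scale T.
  apply: prank_leS => //; exists B, (fun x => b * f x), g; split=> //.
    by move=> x y xy; rewrite (f_B x y).
  by move=> x; rewrite ffunE TE mulrA.
by apply/ffunP => x; rewrite !ffunE mulrDr.
Qed.

Lemma prank_le_sum D (J : finType) (P : pred J) m
    (T : J -> {ffun {ffun I -> X} -> K}) :
  (forall j, P j -> prank_le D (m j) (T j)) ->
  prank_le D (\sum_(j | P j) m j) (\sum_(j | P j) T j).
Proof.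
by apply: (big_ind2 (prank_le D)) => [|m1 T1 m2 T2]; [left|apply: prank_leD].
Qed.

Lemma splits_set1 d T : ~ splits [set d] T.
Proof.
case=> B [f [g [B0 B_d _ _ _]]]; have := proper_card B_d.
by rewrite cards1 ltnS leqn0 cards_eq0 (negPf B0).
Qed.

Definition update x d a : {ffun I -> X} := [ffun i => if i == d then a else x i].

Definition contract h d T : {ffun {ffun I -> X} -> K} :=
  [ffun x => \sum_a h a * T (update x d a)].

Lemma contract0 h d : contract h d 0 = 0.
Proof. by apply/ffunP => x; rewrite !ffunE big1 // => a _; rewrite ffunE mulr0. Qed.

Lemma contractD h d T1 T2 :
  contract h d (T1 + T2) = contract h d T1 + contract h d T2.
Proof.
apply/ffunP => x; rewrite !ffunE -big_split /=; apply: eq_bigr => a _.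
by rewrite ffunE mulrDr.
Qed.

Lemma depends_on_update B f x d a :
  depends_on B f -> d \notin B -> f (update x d a) = f x.
Proof.
move=> f_B dB; apply: f_B => i iB; rewrite ffunE.
by case: eqP iB dB => // -> ->.
Qed.

(** Contracting the variable d keeps the splitting unless d is alone on its
    side, since then the other side would face an empty part. In that case the
    contraction is a scalar multiple of the other factor, and the scalar
    vanishes when h is orthogonal to the factor carried by d. *)
Lemma splits_contract D d T : d \in D -> splits D T ->
  (exists phi : {ffun X -> K}, forall h,
     \sum_a h a * phi a = 0 -> contract h d T = 0)
  \/ (forall h, splits (D :\ d) (contract h d T)).
Proof.
move=> dD T_s.
(* The two sides play symmetric roles. *)
have {T_s} [B [f [g [dB [B0 BD f_B g_B TE]]]]] : exists B f g, d \in B /\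
    [/\ B != set0, B \proper D, depends_on B f, depends_on (D :\: B) g
      & forall x, T x = f x * g x].
  case: T_s => B [f [g [B0 BD f_B g_B TE]]].
  have [dB|dB] := boolP (d \in B); first by exists B, f, g.
  have /properP[B_D [e eD eB]] := BD.
  exists (D :\: B), g, f; split; first by rewrite inE dB.
  split=> //.
  - by apply/set0Pn; exists e; rewrite inE eB.
  - have /set0Pn[b bB] := B0.
    apply/properP; split; first exact: subsetDl.
    by exists b; rewrite ?inE ?bB // (subsetP B_D).
  - by rewrite setDDr setDv set0U (setIidPr B_D).
  by move=> x; rewrite TE mulrC.
have gE x a : g (update x d a) = g x.
  by apply: depends_on_update g_B _; rewrite inE dB.
have [B_d|B_d] := eqVneq (B :\ d) set0.
  left; exists [ffun a => f [ffun=> a]] => h h_phi; apply/ffunP => x.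
  rewrite !ffunE; apply: etrans (mul0r (g x)).
  apply: etrans (congr1 ( *%R^~ (g x)) h_phi); rewrite /= big_distrl /=.
  apply: eq_bigr => a _; rewrite TE gE mulrA ffunE; congr (_ * _ * _).
  apply: f_B => i iB; rewrite !ffunE; case: eqP => // i_d.
  have : i \in B :\ d by rewrite !inE iB; apply/andP; split=> //; apply/eqP.
  by rewrite B_d inE.
right=> h; exists (B :\ d), (fun x => \sum_a h a * f (update x d a)), g.
split=> //.
- have /properP[B_D [e eD eB]] := BD; apply/properP; split; first exact: setSD.
  exists e; rewrite !inE ?(negPf eB) ?andbF // eD andbT.
  by apply: contraNneq eB => ->.
- move=> x y xy; apply: eq_bigr => a _; congr (_ * _); apply: f_B => i iB.
  by rewrite !ffunE; case: eqP => // /eqP i_d; apply: xy; rewrite !inE i_d.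
- move=> x y xy; apply: g_B => i; rewrite inE => /andP[iB iD]; apply: xy.
  rewrite !inE (negPf iB) andbF iD andbT /=.
  by apply: contraNneq iB => ->.
move=> x; rewrite !ffunE big_distrl /=; apply: eq_bigr => a _.
by rewrite TE gE mulrA.
Qed.

Lemma prank_le_contract D d m T : d \in D -> prank_le D m T ->
  exists2 phis, (size phis <= m)%N & forall h, annihilates h phis ->
    prank_le (D :\ d) (m - size phis) (contract h d T).
Proof.
move=> dD; elim=> [|{}m T1 {}T T1_s _ [phis le_phis T_le]].
  by exists [::] => // h _; rewrite contract0; left.
have [[phi phiP]|T1_c] := splits_contract dD T1_s.
  exists (phi :: phis) => // h h_ann; rewrite /= subSS contractD.
  rewrite phiP ?add0r; last by apply: h_ann; rewrite mem_head.
  by apply: T_le => psi psi_in; apply: h_ann; rewrite in_cons psi_in orbT.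
exists phis => [|h h_ann]; first exact: leqW.
by rewrite subSn // contractD; apply: prank_leS => //; apply: T_le.
Qed.

Definition diagonal D c : {ffun {ffun I -> X} -> K} :=
  [ffun x : {ffun I -> X} => \sum_a c a * [forall i in D, x i == a]%:R].

Lemma contract_diagonal D d h c : d \in D ->
  contract h d (diagonal D c) = diagonal (D :\ d) [ffun a => h a * c a].
Proof.
move=> dD; apply/ffunP => x; rewrite !ffunE; apply: eq_bigr => a _.
rewrite ffunE (bigD1 a) //= big1 ?addr0 => [|b b_a].
  rewrite ffunE mulrA; congr (_ * _%:R); congr nat_of_bool.
  apply/forall_inP/forall_inP => xa i.
    by rewrite !inE => /andP[i_d iD]; have := xa i iD; rewrite ffunE (negPf i_d).
  by move=> iD; rewrite ffunE; have [//|i_d] := eqVneq i d; apply: xa;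
    rewrite !inE i_d.
case: forall_inP => [/(_ d dD)|_]; last by rewrite mulr0.
by rewrite ffunE eqxx eq_sym (negPf b_a).
Qed.

(** The variables are removed one at a time by contraction. If r terms have d
    alone on one side, there is an h orthogonal to these r functions and nonzero
    on all but r points of the support of c. Contracting with it kills the r
    terms and leaves a diagonal tensor with support smaller by at most r. With
    one variable left nothing splits, so the tensor is 0. *)
Lemma leq_support_diagonal D m c : D != set0 ->
  prank_le D m (diagonal D c) -> (#|[set a | c a != 0%R]| <= m)%N.
Proof.
move: {2}#|D| (leqnn #|D|) => N; elim: N => [|N IH] in D m c *.
  by rewrite leqn0 cards_eq0 => ->.
move=> D_N /set0Pn[d dD] D_le.
have [D_d|D_d] := eqVneq (D :\ d) set0.
  have {}D_d : D = [set d] by rewrite -(setD1K dD) D_d setU0.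
  suff diag0 : diagonal D c = 0.
    rewrite (_ : [set _ | _] = set0) ?cards0 //.
    apply/setP => a; rewrite !inE; apply/negbTE; rewrite negbK.
    have /ffunP/(_ [ffun=> a]) := diag0; rewrite !ffunE (bigD1 a) //= big1.
      rewrite addr0 => <-; suff -> : [forall i in D, [ffun=> a] i == a].
        by rewrite mulr1.
      by apply/forall_inP => i _; rewrite ffunE.
    move=> b b_a; case: forall_inP => [/(_ d dD)|_]; last by rewrite mulr0.
    by rewrite ffunE eq_sym (negPf b_a).
  move: D_le; rewrite D_d; case=> // {}m T1 T /splits_set1 [].
have [phis le_phis c_le] := prank_le_contract dD D_le.
have [h h_ann h_supp] := annihilator_large_support [set a | c a != 0] phis.
apply: leq_trans h_supp _; rewrite -leq_subRL //.
have := c_le h h_ann; rewrite contract_diagonal // => /IH le_supp.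
apply: leq_trans (le_supp _ D_d).
  apply/subset_leq_card/subsetP => a; rewrite !inE ffunE.
  by rewrite mulf_eq0 negb_or andbC.
by rewrite -ltnS (leq_trans _ D_N) // [leqRHS](cardsD1 d) dD.
Qed.

End PartitionRank.

(** * Set partitions and tuples constant on their blocks *)

Section Retraction.
Variables (t : nat) (P : setpart t).

Lemma block_rep_ex (i : 'I_#|val P|) : exists j, j \in enum_val i.
Proof.
apply/set0Pn; have /and3P[_ _ P0] := valP P.
by apply: contraNneq P0 => <-; apply: enum_valP.
Qed.

Definition block_rep (i : 'I_#|val P|) : 'I_t := xchoose (block_rep_ex i).

Lemma block_idx_rep i : block_idx P (block_rep i) = i.
Proof. by apply/eqP; rewrite -block_idxP; apply: xchooseP. Qed.

Definition block_retract (j : 'I_t) : 'I_t := block_rep (block_idx P j).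

Lemma block_idx_retract j : block_idx P (block_retract j) = block_idx P j.
Proof. exact: block_idx_rep. Qed.

Lemma setT_in_setpart : (0 < t)%N -> [set: 'I_t] \in val P -> val P = one_block t.
Proof.
move=> t_gt0 TP; apply/eqP; rewrite eqEsubset sub1set TP andbT.
apply/subsetP => B BP; rewrite inE; apply/eqP.
have /and3P[_ /trivIsetP tP P0] := valP P.
have [//|/(tP B _ BP TP)] := eqVneq B [set: 'I_t].
by rewrite -setI_eq0 setIT => /eqP B0; rewrite -B0 BP in P0.
Qed.

Lemma one_blockP : (0 < t)%N ->
  reflect (forall j j', block_idx P j = block_idx P j') (val P == one_block t).
Proof.
move=> t_gt0; apply: (iffP eqP) => [P1 j j'|idx_eq].
  apply/eqP; rewrite -block_idxP;
  suff /set1P -> : enum_val (block_idx P j') \in one_block t by rewrite inE.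
  by rewrite -P1 enum_valP.
apply: setT_in_setpart => //; pose i := block_idx P (Ordinal t_gt0).
have i_T : enum_val i = [set: 'I_t]; last by have := enum_valP i; rewrite i_T.
by apply/setP => j; rewrite inE block_idxP; apply/eqP/idx_eq.
Qed.

(** Constancy is tested against one chosen representative per block, so that
    the indicator factors over any union of blocks. *)
Definition constant_on_blocks (X : eqType) (x : {ffun 'I_t -> X}) :=
  [forall j, x (block_retract j) == x j].

End Retraction.

(** * Expanding the indicator of injectivity over set partitions *)

Section Forests.
Variable t : nat.
Hypothesis t_gt0 : (0 < t)%N.
Implicit Type s : {ffun 'I_t -> 'I_t}.

(** Each j points to a parent s j < j, or to itself if it is a root. Such maps
    index the terms of the expansion of
    \prod_j (1 - \sum_(i < j) [x_i = x_j]). *)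
Definition forest s := s \in family (fun j : 'I_t => [pred i : 'I_t | i <= j]%N).

Lemma forestP s : reflect (forall j, s j <= j)%N (forest s).
Proof. by apply: (iffP familyP) => s_le j; apply: s_le. Qed.

Definition forest_root s (j : 'I_t) := iter t s j.

Lemma forest_rootK s j : forest s -> s (forest_root s j) = forest_root s j.
Proof.
move=> /forestP s_le; rewrite /forest_root.
(* The iterates decrease strictly until they meet a root, so l steps are
   enough from l. *)
suff stable m (l : 'I_t) : (l <= m)%N -> s (iter m s l) = iter m s l.
  by apply: stable; apply: ltnW.
elim: m l => [|m IHm] l l_m.
  by apply/val_inj/eqP; rewrite /= eqn_leq s_le (leq_trans l_m).
have [sl|sl] := eqVneq (s l) l; first by rewrite iter_fix.
by rewrite iterSr IHm // -ltnS (leq_trans _ l_m) // ltn_neqAle sl s_le.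
Qed.

Lemma forest_root_parent s j : forest s -> forest_root s (s j) = forest_root s j.
Proof. by move=> s_f; rewrite /forest_root -iterSr iterS; apply: forest_rootK. Qed.

Definition forest_partition s : setpart t :=
  Sub (preim_partition (forest_root s) [set: 'I_t])
      (preim_partitionP (forest_root s) [set: 'I_t]).

Lemma block_idx_forest s i j :
  (block_idx (forest_partition s) i == block_idx (forest_partition s) j)
    = (forest_root s i == forest_root s j).
Proof.
rewrite -block_idxP /block_idx enum_rankK_in ?pblock_setpart //.
rewrite pblock_equivalence_partition ?inE //.
by split=> // /eqP ->.
Qed.

Lemma constant_on_forest (X : eqType) (x : {ffun 'I_t -> X}) s : forest s ->
  constant_on_blocks (forest_partition s) x = [forall j, x (s j) == x j].
Proof.
move=> s_f; set P := forest_partition s.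
apply/forallP/forallP => xs j.
  have /eqP idx : block_idx P (s j) == block_idx P j.
    by rewrite block_idx_forest forest_root_parent.
  by rewrite -(eqP (xs (s j))) /block_retract idx; apply: xs.
have x_iter m l : x (iter m s l) = x l.
  by elim: m => //= m <-; apply/eqP/xs.
have x_root l : x (forest_root s l) = x l by apply: x_iter.
rewrite -x_root -(x_root j); apply/eqP; congr (x _); apply/eqP.
by rewrite -block_idx_forest block_idx_retract.
Qed.

(** The index 0 is always a root, and distinct roots lie in distinct trees. *)
Lemma forest_one_block s : forest s ->
  (val (forest_partition s) == one_block t)
    = [forall j : 'I_t, (0 < j)%N ==> (s j < j)%N].
Proof.
move=> s_f; have /forestP s_le := s_f; pose o := Ordinal t_gt0.
have so : s o = o by apply/val_inj/eqP; rewrite -leqn0; apply: s_le.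
have root_o : forest_root s o = o by apply: iter_fix.
apply/one_blockP/forallP => // [idx_eq j|s_lt i j].
  apply/implyP => j_gt0; rewrite ltn_neqAle s_le andbT.
  apply: contraL j_gt0 => /eqP/val_inj sj.
  have /eqP := idx_eq j o; rewrite block_idx_forest root_o.
  by rewrite /forest_root iter_fix // => /eqP ->.
have root0 l : forest_root s l = o.
  apply/val_inj/eqP; rewrite -leqn0 leqNgt; apply/negP => root_gt0.
  by have /implyP/(_ root_gt0) := s_lt (forest_root s l); rewrite forest_rootK ?ltnn.
by apply/eqP; rewrite block_idx_forest !root0.
Qed.

Variable K : fieldType.

Definition edge_weight (j i : 'I_t) : K := if i == j then 1 else -1.

Definition forest_sign s : K := \prod_j edge_weight j (s j).

(** The factor of j is 1 - \sum_(i < j) [x_i = x_j]. If x is not injective and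
    j is the first index whose value occurred before, it did so exactly once, so
    this factor is 1 - 1 = 0. *)
Lemma injective_prod (X : eqType) (x : {ffun 'I_t -> X}) :
  (injectiveb x)%:R
    = \prod_(j < t) \sum_(i < t | (i <= j)%N) edge_weight j i * (x i == x j)%:R :> K.
Proof.
have split_j (j : 'I_t) :
    \sum_(i < t | (i <= j)%N) edge_weight j i * (x i == x j)%:R
      = 1 - \sum_(i < t | (i < j)%N) (x i == x j)%:R :> K.
  rewrite (bigD1 j) //= /edge_weight !eqxx mul1r -sumrN; congr (_ + _).
  apply: eq_big => [i|i]; first by rewrite ltn_neqAle andbC.
  by case/andP=> _ /negPf ->; rewrite mulN1r.
have [x_inj|] := injectiveP x.
  rewrite big1 // => j _; rewrite split_j big1 ?subr0 // => i i_j.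
  by rewrite (inj_eq x_inj) -val_eqE (ltn_eqF i_j).
move=> x_ninj.
pose collides (j : 'I_t) := [exists i : 'I_t, (i < j)%N && (x i == x j)].
have [j0 Cj0] : exists j, collides j.
  apply/existsP; apply: contra_notT x_ninj => /existsPn no_coll i j xij.
  apply/val_inj/eqP; rewrite eqn_leq.
  apply/andP; split; rewrite leqNgt; apply/negP => lt_ij.
    by have /existsP[] := no_coll i; exists j; rewrite lt_ij xij /=.
  by have /existsP[] := no_coll j; exists i; rewrite lt_ij xij /=.
have [j /existsP[i /andP[i_j /eqP xij]] j_min] := arg_minnP val Cj0.
rewrite (bigD1 j) //= split_j (bigD1 i) //= xij eqxx big1 ?addr0 ?subrr ?mul0r //.
move=> l /andP[l_j l_i]; case: eqP => // xlj.
(* If x_l = x_j also for l < j, then l <> i, and the larger of i and l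
   is a collision smaller than j. *)
suff /j_min : collides (if (l < i)%N then i else l)
  by case: ifP => _; rewrite leqNgt ?i_j ?l_j.
apply/existsP; case: ltnP => [l_lt|l_ge]; first by exists l; rewrite l_lt xlj xij /=.
by exists i; rewrite ltn_neqAle eq_sym l_i l_ge xij xlj /=.
Qed.

Lemma injective_forest_sum (X : eqType) (x : {ffun 'I_t -> X}) :
  (injectiveb x)%:R
    = \sum_(s | forest s)
        forest_sign s * (constant_on_blocks (forest_partition s) x)%:R :> K.
Proof.
rewrite injective_prod bigA_distr_big_dep; apply: eq_bigr => s s_f.
rewrite big_split /=; congr (_ * _); rewrite constant_on_forest //.
case: forallP => [xs|/forallP]; first by rewrite big1 // => j _; rewrite xs.
by rewrite negb_forall => /existsP[j /negPf xj]; rewrite (bigD1 j) //= xj mul0r.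
Qed.

(** This is the Moebius function of the partition lattice between the discrete
    partition and P, in the form of a signed count of forests. *)
Definition partition_coef (P : setpart t) : K :=
  \sum_(s | forest s && (forest_partition s == P)) forest_sign s.

Lemma injective_partition_sum (X : eqType) (x : {ffun 'I_t -> X}) :
  (injectiveb x)%:R
    = \sum_P partition_coef P * (constant_on_blocks P x)%:R :> K.
Proof.
rewrite injective_forest_sum (partition_big forest_partition predT) //=.
apply: eq_bigr => P _; rewrite big_distrl /=.
by apply: eq_bigr => s /andP[_ /eqP ->].
Qed.

(** The forests with one tree are given by free choices of a parent for each
    j > 0, with j possibilities and weight -1, so the sum is a product. *)
Lemma partition_coef_one_block (P : setpart t) : val P = one_block t ->
  partition_coef P = \prod_(j < t | (0 < j)%N) - j%:R.
Proof.
move=> P1; pose Q (j : 'I_t) :=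
  [pred i : 'I_t | (i <= j) && ((0 < j) ==> (i < j))]%N.
transitivity (\prod_(j < t) \sum_(i | Q j i) edge_weight j i).
  rewrite bigA_distr_big_dep; apply: eq_bigl => s.
  have [s_f|s_nf] /= := boolP (forest s); last first.
    apply/esym; apply: contraNF s_nf => /familyP s_Q; apply/forestP => j.
    by have /andP[] := s_Q j.
  rewrite -val_eqE P1 forest_one_block //; have /forestP s_le := s_f.
  apply/forallP/familyP => s_lt j; last by have /andP[] := s_lt j.
  by apply/andP; split; [apply: s_le|apply: s_lt].
rewrite [RHS]big_mkcond; apply: eq_bigr => j _.
case: posnP => j_gt0.
  rewrite (big_pred1 j) => [|i]; first by rewrite /edge_weight eqxx.
  by rewrite /= j_gt0 andbT leqn0 -val_eqE /= j_gt0.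
rewrite (eq_bigl (fun i : 'I_t => i < j)%N) => [|i]; last first.
  by rewrite /= j_gt0 /=; case: ltnP => [/ltnW ->|]; rewrite ?andbF.
rewrite (eq_bigr (fun=> -1)) => [|i i_j]; last first.
  by rewrite /edge_weight -val_eqE (ltn_eqF i_j).
rewrite sumr_const mulNrn; congr (- _%:R).
rewrite -sum1_card (big_ord_narrow (ltnW (ltn_ord j))) /=.
by rewrite sum1_card card_ord.
Qed.

Lemma partition_coef_one_block_neq0 (P : setpart t) p :
  p \in [pchar K] -> (t <= p)%N -> val P = one_block t -> partition_coef P != 0.
Proof.
move=> pK t_p P1; rewrite partition_coef_one_block //; apply/prodf_neq0 => j j_gt0.
rewrite oppr_eq0 -(dvdn_pcharf pK) gtnNdvd //.
exact: leq_trans (ltn_ord j) t_p.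
Qed.

End Forests.

(** * From slice rank of contracted tensors to partition rank *)

Section SlicesToSplittings.
Variables (K : finFieldType) (t : nat) (P : setpart t) (X Y : finType).
Variable v : X -> Y.
Hypothesis t_gt0 : (0 < t)%N.
Hypothesis P_neq1 : val P != one_block t.

Local Notation r := #|val P|.
Local Notation point := {dffun forall i : 'I_r, (fun=> Y) i}.

Definition representatives (x : {ffun 'I_t -> X}) : point :=
  [ffun i => v (x (block_rep i))].

Definition lift_tensor (T : {ffun point -> K}) :
    {ffun {ffun 'I_t -> X} -> K} :=
  [ffun x => (constant_on_blocks P x)%:R * T (representatives x)].

Lemma lift_tensor_sum m (T : 'I_m -> {ffun point -> K}) :
  lift_tensor (\sum_(k < m) T k) = \sum_(k < m) lift_tensor (T k).
Proof.
apply/ffunP => x; rewrite !ffunE !sum_ffunE big_distrr /=.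
by apply: eq_bigr => k _; rewrite ffunE.
Qed.

Lemma constant_on_blocks_prod (B : {set 'I_t}) (x : {ffun 'I_t -> X}) :
  (constant_on_blocks P x)%:R
    = [forall j in B, x (block_retract P j) == x j]%:R
      * [forall j in ~: B, x (block_retract P j) == x j]%:R :> K.
Proof.
rewrite -natrM mulnb; congr (_%:R); congr nat_of_bool.
apply/forallP/andP => [xP|[/forall_inP xB /forall_inP xC] j].
  by split; apply/forall_inP => j _.
by have [/xB|jB] := boolP (j \in B); last by apply: xC; rewrite inE.
Qed.

Lemma depends_on_agreement (B : {set 'I_t}) :
  (forall j, j \in B -> block_retract P j \in B) ->
  depends_on B (fun x : {ffun 'I_t -> X} =>
    [forall j in B, x (block_retract P j) == x j]%:R : K).
Proof.
move=> B_stable x y xy; congr (nat_of_bool _)%:R.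
by apply: eq_forallb_in => j jB; rewrite !xy ?B_stable.
Qed.

(** A slice with distinguished variable i splits along the i-th block: the
    constancy indicator is the product of its parts inside and outside this
    block. The block is not everything because P has another block. *)
Lemma splits_slice (T : {ffun point -> K}) :
  is_slice T -> splits [set: 'I_t] (lift_tensor T).
Proof.
case/existsP=> i /existsP[f /existsP[g /eqP ->]].
pose B := enum_val i; exists B.
have repB k : (block_rep k \in B) = (k == i) by rewrite block_idxP block_idx_rep.
have retractB j : (block_retract P j \in B) = (j \in B).
  by rewrite !block_idxP block_idx_retract.
exists (fun x : {ffun 'I_t -> X} =>
          [forall j in B, x (block_retract P j) == x j]%:R
                 * f (v (x (block_rep i)))).
exists (fun x : {ffun 'I_t -> X} =>
          [forall j in ~: B, x (block_retract P j) == x j]%:R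
                 * g (drop_coord i (representatives x))).
split.
- by apply/set0Pn; exists (block_rep i); rewrite repB.
- rewrite properE subsetT subTset; apply: contra P_neq1 => /eqP B_T.
  by apply/eqP/setT_in_setpart => //; have := enum_valP i; rewrite -/B B_T.
- move=> x y xy; congr (_ * f (v _)); last by apply: xy; rewrite repB.
  by apply: depends_on_agreement xy => j; rewrite retractB.
- rewrite setTD => x y xy; congr (_ * g _).
    by apply: depends_on_agreement xy => j; rewrite !inE retractB.
  apply/ffunP => k; rewrite !ffunE xy // inE repB.
  by rewrite eq_sym neq_lift.
move=> x; rewrite !ffunE (constant_on_blocks_prod B) -!mulrA; congr (_ * _).
by rewrite [RHS]mulrCA.
Qed.

Lemma prank_le_lift_tensor (T : {ffun point -> K}) :
  prank_le [set: 'I_t] (srk T) (lift_tensor T).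
Proof.
have r_gt0 : (0 < r)%N.
  exact: leq_ltn_trans (leq0n _) (ltn_ord (block_idx P (Ordinal t_gt0))).
have [/existsP[S /andP[/forallP S_slice /eqP TS]] _] := srkP T r_gt0.
rewrite {2}TS lift_tensor_sum; move: (srk T) S {TS} S_slice => m S S_slice.
suff : prank_le [set: 'I_t] (\sum_(k < m) 1) (\sum_(k < m) lift_tensor (S k)).
  by rewrite sum1_card card_ord.
apply: prank_le_sum => k _; rewrite -[lift_tensor _]addr0.
by apply: prank_leS; [apply: splits_slice | left].
Qed.

End SlicesToSplittings.

(** * The indicator of the zeros of F *)

Section ZeroIndicator.
Variables (K : finFieldType) (t n : nat) (F : {mpoly K[t]}).

Definition zero_indicator (a : 'I_t -> 'rV[K]_n) : K :=
  \prod_(h < n) (1 - F.@[fun j => a j 0 h] ^+ #|K|.-1).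

Lemma zero_indicatorE a :
  zero_indicator a = [forall h : 'I_n, F.@[fun j => a j 0 h] == 0]%:R.
Proof.
have q1_gt0 : (0 < #|K|.-1)%N by rewrite -subn1 subn_gt0 finNzRing_gt1.
rewrite /zero_indicator; case: forallP => [F0|/forallP].
  by rewrite big1 // => h _; rewrite (eqP (F0 h)) expr0n eqn0Ngt q1_gt0 subr0.
rewrite negb_forall => /existsP[h Fh]; rewrite (bigD1 h) //=.
suff -> : F.@[fun j => a j 0 h] ^+ #|K|.-1 = 1 by rewrite subrr mul0r.
apply: (mulfI Fh); rewrite mulr1 -exprS prednK ?expf_card //.
exact: ltnW (finNzRing_gt1 K).
Qed.

Lemma tensorT_representatives (X : finType) (v : X -> 'rV[K]_n) (P : setpart t)
    (x : {ffun 'I_t -> X}) :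
  constant_on_blocks P x ->
  tensorT F P n (representatives P v x) = zero_indicator (v \o x).
Proof.
move/forallP => xP; rewrite tensorTE; apply: eq_bigr => h _.
rewrite /tau contractionE; congr (1 - _ ^+ _); apply: meval_eq => j.
by rewrite ffunE /= -(eqP (xP j)).
Qed.

End ZeroIndicator.

(** * Sets without solutions in distinct elements *)

Section SetBound.
Variables (p t n : nat) (K : finFieldType) (F : {mpoly K[t]}).
Hypotheses (t_gt0 : (0 < t)%N) (pK : p \in [pchar K]) (t_lep : (t <= p)%N).
Hypothesis F_diag : forall a : K, F.@[fun=> a] = 0.
Variable A : {set 'rV[K]_n}.
Hypothesis A_free :
  ~ (exists a : 'I_t -> 'rV[K]_n,
       [/\ injective a, forall i, a i \in A
         & forall h : 'I_n, F.@[fun i => a i 0 h] = 0]).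

Local Notation X := {a | a \in A}.

Lemma injective_zero_indicator (x : {ffun 'I_t -> X}) :
  (injectiveb x)%:R * zero_indicator F (val \o x) = 0.
Proof.
rewrite zero_indicatorE; case: injectiveP => [x_inj|_]; last by rewrite mul0r.
case: forallP => [F0|_]; last by rewrite mulr0.
case: A_free; exists (val \o x); split=> [|i|h]; last exact/eqP/F0.
  exact: inj_comp val_inj x_inj.
exact: valP.
Qed.

Lemma partition_one_block : partition (one_block t) [set: 'I_t].
Proof.
rewrite /partition /one_block cover1 eqxx trivIset1 inE eq_sym /=.
by apply/set0Pn; exists (Ordinal t_gt0).
Qed.

Definition setpart1 : setpart t := Sub (one_block t) partition_one_block.

(** The identity [x injective] Z(x) = 0 on A^t, after expansion of the first
    factor over set partitions, solved for the one-block term. *)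
Lemma diagonal_partition_sum :
  diagonal [set: 'I_t] [ffun=> - partition_coef K setpart1]
    = \sum_(P : setpart t | val P != one_block t)
        [ffun x => partition_coef K P
                   * lift_tensor (val : X -> 'rV[K]_n) (tensorT F P n) x].
Proof.
apply/ffunP => x; pose Z := zero_indicator F (val \o x).
have sum0 : \sum_P partition_coef K P * (constant_on_blocks P x)%:R * Z = 0.
  by rewrite -big_distrl /= -injective_partition_sum // injective_zero_indicator.
rewrite sum_ffunE.
have -> : \sum_(P : setpart t | val P != one_block t)
     [ffun x => partition_coef K P
                * lift_tensor (val : X -> 'rV[K]_n) (tensorT F P n) x] x
   = \sum_(P | P != setpart1)
       partition_coef K P * (constant_on_blocks P x)%:R * Z.
  apply: eq_big => // P _; rewrite 2!ffunE -mulrA; congr (_ * _).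
  have [xP|_] := boolP (constant_on_blocks P x); last by rewrite !mul0r.
  by rewrite tensorT_representatives.
move: sum0; rewrite (bigD1 setpart1) //= => /eqP; rewrite addrC addr_eq0 => /eqP ->.
rewrite ffunE; under eq_bigr do rewrite ffunE.
have x1 : constant_on_blocks setpart1 x = [forall j, x j == x (Ordinal t_gt0)].
  have idx := elimT (one_blockP setpart1 t_gt0) (eqxx _).
  have retr j j' : block_retract setpart1 j = block_retract setpart1 j'.
    by rewrite /block_retract (idx j j').
  apply/forallP/forallP => xc j; last by rewrite (eqP (xc j)) (eqP (xc _)).
  by rewrite -(eqP (xc j)) -(eqP (xc (Ordinal t_gt0))) (retr j (Ordinal t_gt0)).
rewrite x1 (bigD1 (x (Ordinal t_gt0))) //= big1 ?addr0 => [|a a_x]; last first.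
  case: forall_inP => [/(_ (Ordinal t_gt0) (in_setT _))|_]; last by rewrite mulr0.
  by rewrite eq_sym (negPf a_x).
rewrite mulNr; congr (- _).
have -> : [forall i in [set: 'I_t], x i == x (Ordinal t_gt0)]
          = [forall j, x j == x (Ordinal t_gt0)].
  by apply: eq_forallb => i; rewrite inE.
case: forallP => [xc|_]; last by rewrite !mulr0 mul0r.
suff -> : Z = 1 by rewrite !mulr1.
rewrite /Z zero_indicatorE.
suff -> : [forall h : 'I_n, F.@[fun j => (val \o x) j 0 h] == 0] by [].
apply/forallP => h; apply/eqP; rewrite -(F_diag (val (x (Ordinal t_gt0)) 0 h)).
by apply: meval_eq => j; rewrite /= (eqP (xc j)).
Qed.

Lemma card_free_set_le :
  (#|A| <= \sum_(P : setpart t | val P != one_block t) srk (tensorT F P n))%N.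
Proof.
set N := (\sum_(P | _) _)%N.
have diag_le : prank_le [set: 'I_t] N
    (diagonal [set: 'I_t] [ffun=> - partition_coef K setpart1]
       : {ffun {ffun 'I_t -> X} -> K}).
  rewrite diagonal_partition_sum; apply: prank_le_sum => P P1.
  by apply: prank_leZ; apply: prank_le_lift_tensor.
have := leq_support_diagonal _ diag_le.
rewrite (_ : [set a | _] = setT) ?cardsT ?card_sig => [|]; last first.
  apply/setP => a; rewrite !inE ffunE oppr_eq0.
  exact: partition_coef_one_block_neq0 pK t_lep _.
by apply; apply/set0Pn; exists (Ordinal t_gt0).
Qed.

End SetBound.

(** * From sets to sequences *)

Section SequenceBound.
Variables (t n : nat) (K : finFieldType) (F : {mpoly K[t]}).
Hypothesis F_diag : forall a : K, F.@[fun=> a] = 0.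
Variable S : seq 'rV[K]_n.
Hypothesis S_free :
  ~ (exists s : 'I_t -> 'I_(size S),
       injective s /\ forall h : 'I_n, F.@[fun i => nth 0 S (s i) 0 h] = 0).

Lemma multiplicity_lt a : (#|[pred i : 'I_(size S) | nth 0%R S i == a]| < t)%N.
Proof.
rewrite ltnNge; apply/negP => t_le; apply: S_free.
exists (fun i => enum_val (widen_ord t_le i)); split=> [i j /enum_val_inj|h].
  by move/(congr1 val) => /= /val_inj.
rewrite -(F_diag (a 0 h)); apply: meval_eq => i.
by have := enum_valP (widen_ord t_le i); rewrite inE => /eqP ->.
Qed.

Lemma value_set_free :
  ~ (exists a : 'I_t -> 'rV[K]_n,
       [/\ injective a, forall i, a i \in [set x in S]
         & forall h : 'I_n, F.@[fun i => a i 0 h] = 0]).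
Proof.
case=> a [a_inj aS F0]; apply: S_free.
have lt_index i : (index (a i) S < size S)%N.
  by rewrite index_mem; have := aS i; rewrite inE.
have nthE i : nth 0 S (index (a i) S) = a i.
  by apply: nth_index; have := aS i; rewrite inE.
exists (fun i => Ordinal (lt_index i)); split=> [i j [ij]|h].
  by apply: a_inj; rewrite -nthE ij nthE.
by rewrite -(F0 h); apply: meval_eq => i; rewrite /= nthE.
Qed.

Lemma size_le_card_values : (size S <= (t - 1) * #|[set x in S]|)%N.
Proof.
rewrite -[size S in leqLHS]card_ord -[#|'I__|]sum1_card.
rewrite (partition_big (fun i : 'I_(size S) => nth 0 S i)
                        (fun a => a \in [set x in S])) /=.
  rewrite mulnC -sum_nat_const; apply: leq_sum => a _.
  rewrite sum1_card; have := multiplicity_lt a.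
  by case: (t) => // t'; rewrite ltnS subn1.
by move=> i _; rewrite inE mem_nth.
Qed.

End SequenceBound.

Theorem theorem4p3 (p k t n : nat) (K : finFieldType) (F : {mpoly K[t]})
  (p_prime : prime p) (k_gt0 : (0 < k)%N) (cardK : #|K| = (p ^ k)%N)
  (t_ge2 : (2 <= t)%N) (t_lep : (t <= p)%N) (n_ge1 : (1 <= n)%N)
  (F_diag : forall a : K, F.@[fun=> a] = 0) :
  (forall A : {set 'rV[K]_n},
     ~ (exists a : 'I_t -> 'rV[K]_n,
          [/\ injective a,
              forall i, a i \in A
            & forall h : 'I_n, F.@[fun i => a i 0 h] = 0]) ->
     (#|A| <= \sum_(P : setpart t | val P != one_block t)
                 srk (tensorT F P n))%N)
  /\
  (forall S : seq 'rV[K]_n,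
     ~ (exists s : 'I_t -> 'I_(size S),
          injective s
          /\ forall h : 'I_n, F.@[fun i => nth 0 S (s i) 0 h] = 0) ->
     (size S <= (t - 1) * \sum_(P : setpart t | val P != one_block t)
                            srk (tensorT F P n))%N).
Proof.
have t_gt0 : (0 < t)%N by apply: ltnW.
have pK : p \in [pchar K] by apply: card_finPcharP cardK p_prime.
have set_bound A := @card_free_set_le p t n K F t_gt0 pK t_lep F_diag A.
split=> // S S_free; apply: leq_trans (size_le_card_values F_diag S_free) _.
by rewrite leq_mul2l set_bound ?orbT //; apply: value_set_free.
Qed.
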